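(* Let $C$ be a special timelike Frenet curve in $E_1^4$, parametrized by arc-length by $\mathbf{c}:I\to E_1^4$, whose first and second curvature functions $k_1,k_2$ are non-constant and satisfy, for some constant $\beta$, $$k_1(t)=-\beta\left(k_1^2(t)-k_2^2(t)\right)\qquad\text{for all } t\in I\subset\mathbb{R}.$$ If the timelike curve $C^*$ given by $$\mathbf{c}^*(t)=\mathbf{c}(t)+\beta N(t),\qquad t\in I,$$ is a special timelike Frenet curve, then $C^*$ is a generalized timelike Mannheim mate curve of $C$.
   Context: $E_1^4$ is Minkowski space-time: $\mathbb{R}^4$ with the metric $\langle\,,\,\rangle=-dx_1^2+dx_2^2+dx_3^2+dx_4^2$, and $\|v\|=\sqrt{|\langle v,v\rangle|}$. A vector $v$ is timelike if $\langle v,v\rangle<0$; a curve is timelike if all its velocity vectors are timelike. All curves are regular and $C^\infty$; $I\subset\mathbb{R}$ is an interval. A timelike curve $C$ parametrized by arc-length by $\mathbf{c}:I\to E_1^4$ (so $\langle \mathbf{c}',\mathbf{c}'\rangle=-1$) is a special timelike Frenet curve if there are smooth functions $k_1>0$, $k_2>0$, $k_3\neq 0$ (nowhere zero) on $I$ and a smooth positively oriented frame field $\{T,N,B_1,B_2\}$ along $C$ with $T=\mathbf{c}'$, mutually orthogonal, $\langle T,T\rangle=-1$, $\langle N,N\rangle=\langle B_1,B_1\rangle=\langle B_2,B_2\rangle=1$, such that $$T'=k_1N,\quad N'=k_1T+k_2B_1,\quad B_1'=-k_2N+k_3B_2,\quad B_2'=-k_3B_1 .$$ The functions $k_1,k_2,k_3$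 are the first, second and third curvature functions. A regular timelike curve given in a general parameter, such as $C^*$ above (whose parameter $t$ need not be its arc-length), is a special timelike Frenet curve if its arc-length reparametrization is. The first, second and third normal lines of a special timelike Frenet curve at a point are the lines through that point in the directions $N$, $B_1$, $B_2$ respectively. A special timelike Frenet curve $C^*$ is a generalized timelike Mannheim mate curve of a special timelike Frenet curve $C$ if there is a bijection $\phi:C\to C^*$ such that the first normal line at each point of $C$ is included in the plane generated by the second normal line and the third normal line of $C^*$ at the corresponding point under $\phi$. Here the correspondence is $\phi:\mathbf{c}(t)\mapsto\mathbf{c}(t)+\beta N(t)$. *)

(* Defs.v *)
From HB Require Import structures.
From mathcomp Require Import all_boot all_order all_algebra.
From mathcomp Require Import all_classical all_reals all_analysis.
Set Implicit Arguments.
Unset Strict Implicit.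
Unset Printing Implicit Defensive.
Import Order.TTheory GRing.Theory Num.Theory.
Import numFieldNormedType.Exports.
Local Open Scope classical_set_scope.
Local Open Scope ring_scope.

(* The interval I may contain endpoints, and functions on I are represented by
   total functions whose values outside I are irrelevant.  Derivatives are hence
   taken along I: the usual ones at interior points (derive1), one-sided ones at
   the endpoints that belong to I. *)

Definition nondegenerate_interval (R : realType) (I : set R) : Prop :=
  is_interval I /\ exists a b, [/\ I a, I b & a < b].

Definition slope (R : realType) (V : normedModType R) (f : R -> V) (t x : R)
  : V := (x - t)^-1 *: (f x - f t).

Definition derivable_in (R : realType) (V : normedModType R) (I : set R)
    (f : R -> V) (t : R) : Prop :=
  cvg (slope f t x @[x --> within I t^']).

Definition derive_in (R : realType) (V : normedModType R) (I : set R)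
    (f : R -> V) (t : R) : V :=
  lim (slope f t x @[x --> within I t^']).

Definition smooth_in (R : realType) (V : normedModType R) (I : set R)
    (f : R -> V) : Prop :=
  forall (n : nat) (t : R), I t -> derivable_in I (iter n (derive_in I) f) t.

Definition constant_in (R : realType) (I : set R) (f : R -> R) : Prop :=
  exists a, forall t, I t -> f t = a.

(* Coordinate 0 is the time coordinate x_1. *)
Definition minkowski (R : realType) (u v : 'rV[R]_4) : R :=
  \sum_(i < 4) (if i == 0 then -1 else 1) * u 0 i * v 0 i.

Definition minkowski_norm (R : realType) (v : 'rV[R]_4) : R :=
  Num.sqrt `|minkowski v v|.

Definition timelike (R : realType) (v : 'rV[R]_4) : Prop := minkowski v v < 0.

Definition timelike_curve (R : realType) (I : set R) (c : R -> 'rV[R]_4)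
  : Prop :=
  [/\ nondegenerate_interval I, smooth_in I c &
      forall t, I t -> timelike (derive_in I c t)].

(* The Frenet frame and the curvatures at one point of a curve. *)
Record frenet_data (R : realType) := FrenetData {
  frT : 'rV[R]_4; frN : 'rV[R]_4; frB1 : 'rV[R]_4; frB2 : 'rV[R]_4;
  frk1 : R; frk2 : R; frk3 : R }.

Definition positively_oriented (R : realType) (u1 u2 u3 u4 : 'rV[R]_4)
  : Prop :=
  0 < \det (\matrix_(i < 4) tnth [tuple u1; u2; u3; u4] i).

Definition frenet_frame (R : realType) (F : frenet_data R) : Prop :=
  [/\ [/\ minkowski (frT F) (frN F) = 0, minkowski (frT F) (frB1 F) = 0,
          minkowski (frT F) (frB2 F) = 0 &
        [/\ minkowski (frN F) (frB1 F) = 0, minkowski (frN F) (frB2 F) = 0 &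
            minkowski (frB1 F) (frB2 F) = 0]],
      [/\ minkowski (frT F) (frT F) = -1, minkowski (frN F) (frN F) = 1,
          minkowski (frB1 F) (frB1 F) = 1 & minkowski (frB2 F) (frB2 F) = 1] &
      positively_oriented (frT F) (frN F) (frB1 F) (frB2 F)].

Definition frenet_smooth (R : realType) (I : set R) (F : R -> frenet_data R)
  : Prop :=
  [/\ smooth_in I (fun t => frT (F t)), smooth_in I (fun t => frN (F t)),
      smooth_in I (fun t => frB1 (F t)), smooth_in I (fun t => frB2 (F t)) &
    [/\ smooth_in I (fun t => frk1 (F t)), smooth_in I (fun t => frk2 (F t)) &
        smooth_in I (fun t => frk3 (F t))]].

Definition frenet_equations (R : realType) (I : set R) (F : R -> frenet_data R)
    (t : R) : Prop :=
  [/\ derive_in I (fun x => frT (F x)) t = frk1 (F t) *: frN (F t),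
      derive_in I (fun x => frN (F x)) t
        = frk1 (F t) *: frT (F t) + frk2 (F t) *: frB1 (F t),
      derive_in I (fun x => frB1 (F x)) t
        = - frk2 (F t) *: frN (F t) + frk3 (F t) *: frB2 (F t) &
      derive_in I (fun x => frB2 (F x)) t = - frk3 (F t) *: frB1 (F t)].

Definition arclength_special_timelike_frenet (R : realType) (I : set R)
    (c : R -> 'rV[R]_4) (F : R -> frenet_data R) : Prop :=
  [/\ timelike_curve I c, frenet_smooth I F &
      forall t, I t ->
        [/\ frT (F t) = derive_in I c t, frenet_frame (F t),
            [/\ 0 < frk1 (F t), 0 < frk2 (F t) & frk3 (F t) != 0] &
            frenet_equations I F t]].

(* s is an arc-length function of c on I, and d : s(I) -> R^4 is c expressed in
   terms of the arc-length. *)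
Definition arclength_reparametrization (R : realType) (I : set R)
    (c : R -> 'rV[R]_4) (s : R -> R) (d : R -> 'rV[R]_4) : Prop :=
  smooth_in I s /\
  forall t, I t -> derive_in I s t = minkowski_norm (derive_in I c t) /\
                   d (s t) = c t.

(* In a general parameter, F t is the frame (and curvatures) at the point c t
   of the arc-length reparametrized curve; no derivatives with respect to t are
   involved in the Frenet equations. *)
Definition special_timelike_frenet (R : realType) (I : set R)
    (c : R -> 'rV[R]_4) (F : R -> frenet_data R) : Prop :=
  timelike_curve I c /\
  exists (s : R -> R) (d : R -> 'rV[R]_4) (G : R -> frenet_data R),
    [/\ arclength_reparametrization I c s d,
        arclength_special_timelike_frenet (s @` I) d G &
        forall t, I t -> F t = G (s t)].

Definition line_through (R : realType) (p v : 'rV[R]_4) : set 'rV[R]_4 :=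
  [set x | exists a : R, x = p + a *: v].

Definition plane_through (R : realType) (p u v : 'rV[R]_4) : set 'rV[R]_4 :=
  [set x | exists a b : R, x = p + a *: u + b *: v].

(* The curve c' on I' is a mate of the curve c on I under the correspondence
   phi; curves are identified with their sets of points. *)
Definition generalized_timelike_mannheim_mate (R : realType)
    (I : set R) (c : R -> 'rV[R]_4) (F : R -> frenet_data R)
    (I' : set R) (c' : R -> 'rV[R]_4) (F' : R -> frenet_data R)
    (phi : 'rV[R]_4 -> 'rV[R]_4) : Prop :=
  [/\ special_timelike_frenet I c F, special_timelike_frenet I' c' F',
      set_bij (c @` I) (c' @` I') phi &
      forall t t', I t -> I' t' -> phi (c t) = c' t' ->
        line_through (c t) (frN (F t)) `<=`
        plane_through (c' t') (frB1 (F' t')) (frB2 (F' t'))].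

(* Main.v *)
(** The relation between k1 and k2 says exactly that the velocity
    c*' = (1 + beta k1) T + beta k2 B1 satisfies <k1 T + k2 B1, c*'> = 0, that is
    <N', T*> = 0.  Since <N, T*> = 0 along the curve, differentiating gives
    <N, dT*/dt> = 0, hence <N, N*> = 0, and N lies in the span of B1* and B2*.
    No derivative of the speed of c* is needed.  The correspondence is a
    well-defined bijection because timelike curves are injective: their time
    coordinate has a nonvanishing derivative. *)

Require Import Defs.
From mathcomp Require Import all_boot all_order all_algebra.
From mathcomp Require Import all_classical all_reals all_analysis.
From mathcomp Require Import ring lra.
(* MathComp-Analysis also has a [minkowski]: this restores the one of Defs. *)
Import Defs.
Set Implicit Arguments.
Unset Strict Implicit.
Unset Printing Implicit Defensive.
Import Order.TTheory GRing.Theory Num.Theory.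
Import numFieldNormedType.Exports.
Local Open Scope classical_set_scope.
Local Open Scope ring_scope.

(** * Calculus of derivatives taken along an interval *)

(** Relational form: it states convergence and names the limit at once, so no value of [lim] has to
    be interpreted before convergence is known. *)
Definition is_derive_in (R : realType) (V : normedModType R) (I : set R)
    (f : R -> V) (t : R) (D : V) : Prop :=
  slope f t x @[x --> within I t^'] --> D.

Lemma derivable_inP (R : realType) (V : normedModType R) (I : set R)
    (f : R -> V) (t : R) :
  derivable_in I f t -> is_derive_in I f t (derive_in I f t).
Proof. by []. Qed.

Lemma is_derive_in_derivable (R : realType) (V : normedModType R) (I : set R)
    (f : R -> V) (t : R) (D : V) :
  is_derive_in I f t D -> derivable_in I f t.
Proof. exact: cvgP. Qed.

(** Convexity of [I] puts points of [I] other than [t] arbitrarily close to [t]. This is what makes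
    derivatives along [I] unique, endpoints included. *)
Lemma within_dnbhs_proper (R : realType) (I : set R) (t : R) :
  nondegenerate_interval I -> I t -> ProperFilter (within I t^').
Proof.
move=> [itvI [a [b [Ia Ib ltab]]]] It; split; last exact: within_filter.
move=> h.
have {h} /nbhs_ballP[e /= e0 he] : \forall x \near t, x != t -> ~ I x by [].
have ball_sub (u : R) : `|u| < e -> u != 0 -> I (t + u) -> False.
  move=> ue u0; apply: he.
    by rewrite /ball/= opprD addrA subrr sub0r normrN.
  by rewrite -subr_eq0 addrAC subrr add0r.
have e2 : 0 < e / 2 by rewrite divr_gt0.
have e2e : e / 2 < e by rewrite ltr_pdivrMr// ltr_pMr// ltr1n.
(* Either [b] lies to the right of [t] or [a] lies to its left. The step [u] goes towards that
   point, capped by [e / 2] to stay in the ball and by the distance to the point to stay in [I]. *)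
have [ltt|ltt] := ltP t b.
- pose u := Num.min (e / 2) (b - t).
  have u0 : 0 < u by rewrite lt_min e2 subr_gt0.
  apply: (ball_sub u); [|by rewrite gt_eqF|].
    by rewrite gtr0_norm// gt_min e2e.
  apply: (itvI t b) => //; rewrite lerDl (ltW u0) /=.
  by rewrite -lerBrDl ge_min lexx orbT.
- have at' : a < t by exact: lt_le_trans ltt.
  pose u := Num.min (e / 2) (t - a).
  have u0 : 0 < u by rewrite lt_min e2 subr_gt0.
  apply: (ball_sub (- u)); [|by rewrite oppr_eq0 gt_eqF|].
    by rewrite normrN gtr0_norm// gt_min e2e.
  apply: (itvI a t) => //; rewrite gerDl oppr_le0 (ltW u0) andbT.
  by rewrite lerBrDr -lerBrDl ge_min lexx orbT.
Qed.

Section DeriveIn.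
Context {R : realType} (I : set R).

Lemma is_derive_in_unique (V : normedModType R) (f : R -> V) t D D' :
  nondegenerate_interval I -> I t ->
  is_derive_in I f t D -> is_derive_in I f t D' -> D = D'.
Proof.
move=> ndI It fD fD'; have PF := @within_dnbhs_proper _ _ _ ndI It.
by rewrite -(norm_cvg_lim fD) -(norm_cvg_lim fD').
Qed.

Lemma is_derive_in_val (V : normedModType R) (f : R -> V) t D :
  nondegenerate_interval I -> I t ->
  is_derive_in I f t D -> derive_in I f t = D.
Proof.
move=> ndI It fD; have PF := @within_dnbhs_proper _ _ _ ndI It.
exact: norm_cvg_lim fD.
Qed.

Lemma near_within_dnbhs (t : R) :
  \forall x \near within I t^', I x /\ x != t.
Proof.
apply: filterI; first exact: withinT.
by apply: cvg_within; exact: withinT.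
Qed.

(** Lets a difference quotient be replaced by an expression that agrees with it only on [I] away
    from [t], where dividing by [x - t] is legitimate. *)
Lemma cvg_within_dnbhs_eq (T : topologicalType) (f g : R -> T) t (l : T) :
  (forall x, I x -> x != t -> f x = g x) ->
  f x @[x --> within I t^'] --> l -> g x @[x --> within I t^'] --> l.
Proof.
move=> fg; apply: cvg_trans; apply: near_eq_cvg.
have := near_within_dnbhs t; apply: filterS => x [Ix xt]; exact: fg.
Qed.

Lemma is_derive_in_cvg (V : normedModType R) (f : R -> V) t D :
  is_derive_in I f t D -> f x @[x --> within I t^'] --> f t.
Proof.
move=> fD.
have h : f t + (x - t) *: slope f t x @[x --> within I t^'] -->
         f t + (t - t) *: D.
  apply: cvgD; first exact: cvg_cst.
  apply: cvgZ fD; apply: cvgB; last exact: cvg_cst.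
  apply: cvg_trans (cvg_within _) _; exact: nbhs_dnbhs.
rewrite subrr scale0r addr0 in h; apply: cvg_within_dnbhs_eq h => x _ xt.
by rewrite /slope scalerA divff ?subr_eq0// scale1r addrC subrK.
Qed.

Lemma is_derive_in_eq (V : normedModType R) (f g : R -> V) t D :
  I t -> (forall x, I x -> f x = g x) ->
  is_derive_in I f t D -> is_derive_in I g t D.
Proof.
move=> It fg; apply: cvg_within_dnbhs_eq => x Ix _.
by rewrite /slope !fg.
Qed.

Lemma is_derive_in_cst (V : normedModType R) (a : V) t :
  is_derive_in I (fun=> a) t 0.
Proof.
apply: (@cvg_within_dnbhs_eq _ (fun=> 0)); last exact: cvg_cst.
by move=> x _ _; rewrite /slope subrr scaler0.
Qed.

Lemma is_derive_in_id t : is_derive_in I id t 1.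
Proof.
apply: (@cvg_within_dnbhs_eq R (fun=> 1)); last exact: cvg_cst.
by move=> x _ xt; rewrite /slope /GRing.scale/= mulVf// subr_eq0.
Qed.

Lemma is_derive_inD (V : normedModType R) (f g : R -> V) t Df Dg :
  is_derive_in I f t Df -> is_derive_in I g t Dg ->
  is_derive_in I (fun x => f x + g x) t (Df + Dg).
Proof.
move=> fD gD; apply: cvg_within_dnbhs_eq (cvgD fD gD) => x _ _ /=.
by rewrite -scalerDr; congr (_ *: _); rewrite opprD addrACA.
Qed.

Lemma is_derive_inZ (V : normedModType R) (a : R) (f : R -> V) t D :
  is_derive_in I f t D -> is_derive_in I (fun x => a *: f x) t (a *: D).
Proof.
move=> fD; apply: cvg_within_dnbhs_eq (cvgZ (cvg_cst a) fD) => x _ _ /=.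
by rewrite /slope -scalerBr !scalerA mulrC.
Qed.

Lemma is_derive_in_comp (V : normedModType R) (s : R -> R) (d : R -> V) t S D :
  is_derive_in I s t S -> is_derive_in (s @` I) d (s t) D ->
  is_derive_in I (d \o s) t (S *: D).
Proof.
(* The slope of [d] at [s t] is completed by the value [D] at [s t] itself. The factorization of the
   slope of [d \o s] then survives at points [x] with [s x = s t], where both sides vanish. *)
move=> sS dD; pose q y := if y == s t then D else slope d (s t) y.
have qsD : q (s x) @[x --> within I t^'] --> D.
  move=> U UD.
  have h : \forall y \near s t, (s @` I) y -> U (q y).
    have : \forall y \near s t, y != s t -> (s @` I) y -> U (slope d (s t) y).
      exact: dD.
    apply: filterS => y hy Jy; rewrite /q; case: eqP => [_|/eqP yst].
      exact: nbhs_singleton.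
    exact: hy.
  have := is_derive_in_cvg sS h; rewrite nbhs_filterE /= => h'.
  have := near_within_dnbhs t; apply: filterS2 h' => x /= h' [Ix _].
  by apply: h'; exists x.
apply: cvg_within_dnbhs_eq (cvgZ sS qsD) => x Ix xt; rewrite /q /slope /=.
case: eqP => [->|/eqP sxt].
  by rewrite !subrr scaler0 scale0r scaler0.
by rewrite scalerA [_^-1 *: _]mulrC -mulrA mulrCA divff ?mulr1// subr_eq0.
Qed.

Lemma is_derive_in_coord (m n : nat) (f : R -> 'M[R]_(m.+1, n.+1)) i j t D :
  is_derive_in I f t D -> is_derive_in I (fun x => f x i j) t (D i j).
Proof.
move=> fD; have := cvg_comp _ _ fD (@coord_continuous _ _ _ i j D).
by apply: cvg_within_dnbhs_eq => x _ _; rewrite /slope /= !mxE.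
Qed.

Lemma is_derive_inM (f g : R -> R) t Df Dg :
  is_derive_in I f t Df -> is_derive_in I g t Dg ->
  is_derive_in I (fun x => f x * g x) t (Df * g t + f t * Dg).
Proof.
move=> fD gD; have gc := is_derive_in_cvg gD.
apply: cvg_within_dnbhs_eq (cvgD (cvgM fD gc) (cvgM (cvg_cst (f t)) gD)).
move=> x _ _ /=; rewrite /slope /GRing.scale /=; ring.
Qed.

End DeriveIn.

(** Strictly between two points of [I], the set [I] is a neighbourhood of [t], so the restriction to
    [I] is invisible. This bridge to the usual derivative makes Rolle's theorem available. *)
Lemma is_derive_in_interior (R : realType) (V : normedModType R) (I : set R)
    (f : R -> V) (a b t : R) (D : V) :
  is_interval I -> I a -> I b -> a < t < b ->
  is_derive_in I f t D -> is_derive t 1 f D.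
Proof.
move=> itvI Ia Ib /andP[lat ltb] fD.
have h : (fun h : R => h^-1 *: (f (h *: 1 + t) - f t)) @ 0^' --> D.
  move=> U /fD UD.
  have {}UD : \forall y \near t, y != t -> I y -> U (slope f t y) by exact: UD.
  have It : \forall y \near t, I y.
    apply: filterS2 (lt_nbhsr lat) (lt_nbhsl ltb) => y ay yb.
    by apply: (itvI a b) => //; rewrite !ltW.
  have sh : h + t @[h --> (0 : R)] --> t.
    by rewrite -[X in _ --> X]add0r; apply: cvgD; [exact: cvg_id|exact: cvg_cst].
  have h0 := sh _ (@filterI _ _ (nbhs_filter t) _ _ UD It); rewrite nbhs_filterE /= in h0.
  apply: (@filterS _ (nbhs (0 : R)) _ _ _ _ h0) => h /= [hU hI] hn0.
  have := hU _ hI; rewrite /slope addrK /GRing.scale/= mulr1; apply.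
  by rewrite -subr_eq0 addrK.
by split; [exact: cvgP h|exact: norm_cvg_lim h].
Qed.

Lemma is_derive_in_continuous (R : realType) (V : normedModType R) (I : set R)
    (f f' : R -> V) :
  (forall t, I t -> is_derive_in I f t (f' t)) -> {within I, continuous f}.
Proof.
move=> fD; apply/subspace_continuousP => t It U Ut.
have h : \forall y \near t, y != t -> I y -> U (f y).
  exact: (is_derive_in_cvg (fD t It)).
apply: (@filterS _ (nbhs t) _ _ _ _ h) => y hy Iy.
have [->|yt] := eqVneq y t; first exact: (nbhs_singleton Ut).
exact: hy.
Qed.

(** * The Minkowski product and orthogonality in a Frenet frame *)

Section Minkowski.
Context {R : realType}.
Implicit Types u v w : 'rV[R]_4.

Lemma minkowskiC u v : minkowski u v = minkowski v u.
Proof. by apply: eq_bigr => i _; rewrite mulrAC. Qed.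

Lemma minkowskiDl u v w : minkowski (u + v) w = minkowski u w + minkowski v w.
Proof.
by rewrite -big_split; apply: eq_bigr => i _ /=; rewrite mxE mulrDr mulrDl.
Qed.

Lemma minkowskiZl a u v : minkowski (a *: u) v = a * minkowski u v.
Proof.
rewrite mulr_sumr; apply: eq_bigr => i _ /=; rewrite mxE; ring.
Qed.

Lemma minkowskiDr u v w : minkowski u (v + w) = minkowski u v + minkowski u w.
Proof. by rewrite minkowskiC minkowskiDl !(minkowskiC u). Qed.

Lemma minkowskiZr a u v : minkowski u (a *: v) = a * minkowski u v.
Proof. by rewrite minkowskiC minkowskiZl minkowskiC. Qed.

(** With a zero time coordinate only squares with sign +1 would remain in [minkowski v v]. *)
Lemma timelike_coord0 v : timelike v -> v 0 0 != 0.
Proof.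
rewrite /timelike => v0; apply: contraTneq v0 => v00; rewrite -leNgt.
apply: sumr_ge0 => i _; case: eqP => [->|_]; first by rewrite v00 mulr0.
by rewrite mul1r -expr2 sqr_ge0.
Qed.

(** Let [w] be [v] with its time coordinate negated, written as a column. The entries of [M *m w]
    are the four given products, and [M] is invertible by its positive determinant. *)
Lemma minkowski_nondegenerate u1 u2 u3 u4 v :
  positively_oriented u1 u2 u3 u4 ->
  minkowski u1 v = 0 -> minkowski u2 v = 0 -> minkowski u3 v = 0 ->
  minkowski u4 v = 0 -> v = 0.
Proof.
rewrite /positively_oriented; set M := \matrix_i _ => detM v1 v2 v3 v4.
pose w : 'cV[R]_4 := \col_j ((if j == 0 then -1 else 1) * v 0 j).
have Mw : M *m w = 0.
  apply/matrixP => i j; rewrite !mxE.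
  have -> : \sum_k M i k * w k j = minkowski (tnth [tuple u1; u2; u3; u4] i) v.
    by apply: eq_bigr => k _; rewrite !mxE; ring.
  by rewrite (tnth_nth 0); case: i => [[|[|[|[|]]]]].
have w0 : w = 0.
  have uM : M \in unitmx by rewrite unitmxE unitfE gt_eqF.
  by rewrite -(mulKmx uM w) Mw mulmx0.
apply/rowP => j; have /colP/(_ j) := w0; rewrite !mxE.
by case: ifP => _; [rewrite mulN1r => /eqP; rewrite oppr_eq0 => /eqP|rewrite mul1r].
Qed.

(** Subtracting from [v] its components along [frB1 F] and [frB2 F] leaves a vector orthogonal to
    the whole frame, hence zero. *)
Lemma frenet_orthogonal_span (F : frenet_data R) v :
  frenet_frame F -> minkowski (frT F) v = 0 -> minkowski (frN F) v = 0 ->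
  v = minkowski (frB1 F) v *: frB1 F + minkowski (frB2 F) v *: frB2 F.
Proof.
move=> [[TN TB1 TB2 [NB1 NB2 B12]] [TT NN B11 B22] po] Tv Nv.
set a := minkowski (frB1 F) v; set b := minkowski (frB2 F) v.
have : v + (-a) *: frB1 F + (-b) *: frB2 F = 0.
  apply: (minkowski_nondegenerate po); rewrite !minkowskiDr !minkowskiZr.
  - by rewrite Tv TB1 TB2 !mulr0 !addr0.
  - by rewrite Nv NB1 NB2 !mulr0 !addr0.
  - by rewrite B11 B12 -/a; ring.
  - by rewrite (minkowskiC _ (frB1 F)) B12 B22 -/b; ring.
by rewrite !scaleNr -addrA -opprD => /eqP; rewrite subr_eq0 => /eqP.
Qed.

Lemma is_derive_in_minkowski (I : set R) (f g : R -> 'rV[R]_4) t Df Dg :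
  is_derive_in I f t Df -> is_derive_in I g t Dg ->
  is_derive_in I (fun x => minkowski (f x) (g x)) t
    (minkowski Df (g t) + minkowski (f t) Dg).
Proof.
move=> fD gD; rewrite /minkowski -big_split /=.
elim: (index_enum _) => [|i r IHr].
  rewrite big_nil; apply: cvg_within_dnbhs_eq (is_derive_in_cst I (0 : R) t).
  by move=> x _ _; rewrite /slope !big_nil.
rewrite big_cons; set e : R := if i == 0 then -1 else 1.
have := is_derive_inD
  (is_derive_inZ (a := e) (is_derive_inM (is_derive_in_coord (i := 0) (j := i) fD)
                                  (is_derive_in_coord (i := 0) (j := i) gD))) IHr.
move=> h; rewrite -!mulrA -mulrDr.
apply: cvg_within_dnbhs_eq h => x _ _; rewrite /slope !big_cons.
by rewrite /GRing.scale/= !mulrA.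
Qed.

End Minkowski.

(** * Injectivity of timelike curves, arc-length and the correspondence of points *)

(** If two parameters gave the same point, Rolle's theorem applied to the time coordinate would
    produce a velocity whose time component is zero, which is impossible for a timelike vector. *)
Lemma timelike_curve_inj (R : realType) (I : set R) (c : R -> 'rV[R]_4) t t' :
  timelike_curve I c -> I t -> I t' -> c t = c t' -> t = t'.
Proof.
move=> [[itvI _] smc tlc].
wlog : t t' / t < t'.
  move=> W It It' ctt'; have [||//] := ltgtP t t'; first by move/W; exact.
  by move/W => /(_ It' It (esym ctt')).
move=> tt' It It' ctt'.
have subI x : x \in `[t, t'] -> I x.
  by rewrite in_itv; exact: itvI.
pose c0 (x : R) : R := c x 0 0.
have c0D x : I x -> is_derive_in I c0 x (derive_in I c x 0 0).
  by move=> Ix; apply: is_derive_in_coord; exact: (smc 0%N x Ix).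
have c0D' x : x \in `]t, t'[ -> is_derive x 1 c0 (derive_in I c x 0 0).
  rewrite in_itv /= => xtt'; apply: (is_derive_in_interior _ It It' xtt') => //.
  by apply: c0D; apply: subI; rewrite in_itv /= !ltW //; case/andP: xtt'.
have [||x xtt' x0] := Rolle tt' (f := c0) _ _ (congr1 (fun v : 'rV[R]_4 => v 0 0) ctt').
- by move=> x /c0D'[].
- apply: continuous_subspaceW (is_derive_in_continuous c0D); exact: subI.
have Ix : I x.
  by move: xtt'; rewrite in_itv => /andP[tx xt]; apply: (itvI t t'); rewrite ?ltW.
have /eqP := timelike_coord0 (tlc x Ix); case.
by rewrite -(derive_val (is_derive := c0D' x xtt')) (derive_val (is_derive := x0)).
Qed.

Lemma is_derive_in_iter_id (R : realType) (I : set R) (n : nat) t :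
  nondegenerate_interval I -> I t ->
  is_derive_in I (iter n (derive_in I) id) t (n == 0)%:R.
Proof.
move=> ndI; elim: n t => [|n IHn] t It; first exact: is_derive_in_id.
apply: is_derive_in_eq It _ (is_derive_in_cst I ((n == 0)%:R : R) t) => x Ix.
by rewrite iterS (is_derive_in_val ndI Ix (IHn x Ix)).
Qed.

(** The identity serves as arc-length function, since [frT] is the velocity and has Minkowski norm
    1. *)
Lemma arclength_special_timelike (R : realType) (I : set R)
    (c : R -> 'rV[R]_4) (F : R -> frenet_data R) :
  arclength_special_timelike_frenet I c F -> special_timelike_frenet I c F.
Proof.
move=> hC; have [tlc _ hF] := hC; have [ndI _ _] := tlc.
split=> //; exists id, c, F; split=> //; last by rewrite image_id.
split=> [n t It|t It]; first exact: is_derive_in_derivable (is_derive_in_iter_id ndI It).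
split=> //; rewrite (is_derive_in_val ndI It (is_derive_in_id I t)).
have [<- [_ [TT _ _ _] _] _ _] := hF t It.
by rewrite /minkowski_norm TT normrN1 sqrtr1.
Qed.

(** The map must act on points, not on parameters: [xget] recovers a parameter from a point, and
    injectivity of [c] makes it the intended one. The default [x0] is reached only off the curve. *)
Lemma image_correspondence (T U V : choiceType) (x0 : T) (I : set T) (c : T -> U)
    (c' : T -> V) :
  {in I &, injective c} -> {in I &, injective c'} ->
  exists phi : U -> V, (forall t, I t -> phi (c t) = c' t) /\
    set_bij (c @` I) (c' @` I) phi.
Proof.
move=> injc injc'.
pose phi u := c' (xget x0 [set t | I t /\ c t = u]).
have phiE t : I t -> phi (c t) = c' t.
  move=> It; rewrite /phi; congr c'.
  have [Is cs] := @xgetI _ x0 [set s | I s /\ c s = c t] t (conj It erefl).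
  by apply: injc => //; exact/mem_set.
exists phi; split => //; split.
- by move=> _ [t It <-]; exists t; rewrite ?phiE.
- move=> _ _ /set_mem[t It <-] /set_mem[t' It' <-]; rewrite !phiE// => h.
  by rewrite (injc' t t') //; exact/mem_set.
- by move=> _ [t It <-]; exists (c t); [exists t|rewrite phiE].
Qed.

(** * The offset curve and its Frenet frame *)

Section MannheimMate.
Context {R : realType} (I : set R) (c : R -> 'rV[R]_4) (F : R -> frenet_data R).
Context (beta : R) (hC : arclength_special_timelike_frenet I c F).
Let cstar (t : R) := c t + beta *: frN (F t).

Lemma is_derive_in_offset t : I t ->
  is_derive_in I cstar t
    ((1 + beta * frk1 (F t)) *: frT (F t) + (beta * frk2 (F t)) *: frB1 (F t)).
Proof.
move=> It; have [[_ smc _] [_ smN _ _ _] hF] := hC.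
have [Tc _ _ [_ DN _ _]] := hF t It.
have := is_derive_inD (derivable_inP (smc 0%N t It))
  (is_derive_inZ (a := beta) (derivable_inP (smN 0%N t It))).
by rewrite /= DN -Tc scalerDr !scalerA addrA scalerDl scale1r.
Qed.

(** Both sides are the velocity of [cstar]: the chain rule for [d \o s] gives the left one, the
    Frenet equations of [c] the right one. Here [f] is the speed of [cstar]. *)
Lemma mate_tangent (s : R -> R) (d : R -> 'rV[R]_4)
    (G : R -> frenet_data R) t :
  timelike_curve I cstar ->
  arclength_reparametrization I cstar s d ->
  arclength_special_timelike_frenet (s @` I) d G -> I t ->
  exists2 f, 0 < f & is_derive_in I s t f /\
    f *: frT (G (s t)) =
      (1 + beta * frk1 (F t)) *: frT (F t) + (beta * frk2 (F t)) *: frB1 (F t).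
Proof.
move=> [ndI _ tl] [sms sE] [[_ smd _] _ hG] It; have [s' _] := sE t It.
exists (derive_in I s t).
  by rewrite s' sqrtr_gt0 normr_gt0 lt_eqF//; exact: tl.
have sD := derivable_inP (sms 0%N t It); split=> //.
have Jt : (s @` I) (s t) by exists t.
have [-> _ _ _] := hG _ Jt.
have h := is_derive_in_comp sD (derivable_inP (smd 0%N _ Jt)).
apply: (is_derive_in_unique ndI It _ (is_derive_in_offset It)).
by apply: is_derive_in_eq It _ h => x Ix; have [_] := sE x Ix.
Qed.

Lemma normal_orthogonal_mate (Fs : R -> frenet_data R) t :
  (forall t, I t ->
     frk1 (F t) = - beta * (frk1 (F t) ^+ 2 - frk2 (F t) ^+ 2)) ->
  special_timelike_frenet I cstar Fs -> I t ->
  minkowski (frT (Fs t)) (frN (F t)) = 0 /\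
  minkowski (frN (Fs t)) (frN (F t)) = 0.
Proof.
move=> hk [tl [s [d [G [rep dG FsG]]]]] It; rewrite (FsG _ It).
have [[ndI _ _] [_ smN _ _ _] hF] := hC.
(* Proved at every point of [I], because this identity is differentiated below. *)
have orthT x : I x -> minkowski (frT (G (s x))) (frN (F x)) = 0.
  move=> Ix; have [f f0 [_ fT]] := mate_tangent tl rep dG Ix.
  have [_ [[TN _ _ [NB1 _ _]] _ _] _ _] := hF x Ix.
  apply: (mulfI (lt0r_neq0 f0)); rewrite -minkowskiZl fT minkowskiDl !minkowskiZl.
  by rewrite TN (minkowskiC (frB1 _)) NB1 !mulr0 addr0.
split; first exact: orthT.
have [f f0 [sD fT]] := mate_tangent tl rep dG It.
have [_ [[TN TB1 _ [NB1 _ _]] [TT _ B11 _] _] _ [_ DN _ _]] := hF t It.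
have [_ [smT _ _ _ _] hG] := dG.
have Jt : (s @` I) (s t) by exists t.
have [_ _ [k1 _ _] [DT _ _ _]] := hG _ Jt.
have TD := is_derive_in_comp sD (derivable_inP (smT 0%N _ Jt)).
have ND := derivable_inP (smN 0%N t It).
(* With f the speed of c*, differentiating <T*, N> = 0 gives
   f k1* <N*, N> = - <T*, k1 T + k2 B1>, which vanishes by the relation hk. *)
have := is_derive_in_minkowski TD ND; rewrite /= DT DN => D.
have D0 : is_derive_in I
    (fun x => minkowski (frT (G (s x))) (frN (F x))) t 0.
  by apply: is_derive_in_eq It _ (is_derive_in_cst I 0 t) => x Ix; rewrite orthT.
have := is_derive_in_unique ndI It D D0.
have -> : minkowski (frT (G (s t)))
    (frk1 (F t) *: frT (F t) + frk2 (F t) *: frB1 (F t)) = 0.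
  (* After multiplication by [f] the product becomes -(1 + beta k1) k1 + beta k2^2 = -(k1 + beta
     (k1^2 - k2^2)), which is zero by [hk]. *)
  apply: (mulfI (lt0r_neq0 f0)); rewrite -minkowskiZl fT.
  rewrite !(minkowskiDl, minkowskiDr, minkowskiZl, minkowskiZr).
  rewrite TT TB1 B11 (minkowskiC (frB1 _)) TB1.
  by have := hk t It; lra.
rewrite addr0 !minkowskiZl => /eqP.
by rewrite !mulf_eq0 (gt_eqF f0) (gt_eqF k1) /= => /eqP.
Qed.

End MannheimMate.

Theorem theorem3p2 (R : realType) (I : set R) (c : R -> 'rV[R]_4)
    (F : R -> frenet_data R) (beta : R)
    (hC : arclength_special_timelike_frenet I c F)
    (hk1 : ~ constant_in I (fun t => frk1 (F t)))
    (hk2 : ~ constant_in I (fun t => frk2 (F t)))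
    (hk : forall t, I t ->
       frk1 (F t) = - beta * (frk1 (F t) ^+ 2 - frk2 (F t) ^+ 2))
    (Fstar : R -> frenet_data R)
    (hCstar :
       special_timelike_frenet I (fun t => c t + beta *: frN (F t)) Fstar) :
  exists phi : 'rV[R]_4 -> 'rV[R]_4,
    (forall t, I t -> phi (c t) = c t + beta *: frN (F t)) /\
    generalized_timelike_mannheim_mate I c F
      I (fun t => c t + beta *: frN (F t)) Fstar phi.
Proof.
have [tlc _ _] := hC; have [tlcs [s [d [G [_ [_ _ hG] FsG]]]]] := hCstar.
have inj (e : R -> 'rV[R]_4) : timelike_curve I e -> {in I &, injective e}.
  by move=> tle t t' /set_mem It /set_mem It'; exact: (timelike_curve_inj tle It It').
have [phi [phiE phi_bij]] := image_correspondence 0 (inj _ tlc) (inj _ tlcs).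
exists phi; split => //; split => //; first exact: arclength_special_timelike.
move=> t t' It It' /=; rewrite phiE // => e _ [a ->].
(* Corresponding points have the same parameter, since the offset curve is injective. *)
have tt' : t = t' by exact: (timelike_curve_inj tlcs).
rewrite -{t' It' e}tt'; have [TN NN] := normal_orthogonal_mate hC hk hCstar It.
have fr : frenet_frame (Fstar t).
  have Jt : (s @` I) (s t) by exists t.
  by rewrite FsG//; have [] := hG _ Jt.
(* The point c + a N equals c* + (a - beta) N, and N expands in B1*, B2* with its Minkowski products
   as coefficients. *)
exists ((a - beta) * minkowski (frB1 (Fstar t)) (frN (F t))),
  ((a - beta) * minkowski (frB2 (Fstar t)) (frN (F t))).
rewrite -[RHS]addrA -!scalerA -scalerDr -(frenet_orthogonal_span fr TN NN).
by rewrite scalerBl -addrA [beta *: _ + _]addrC subrK.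
Qed.
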